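(* Let $X$ be a Polish space, $Y$ a separable metrizable space, and $f:X\to Y$. Then $f^{-1}(A)$ is ${\bf\Sigma}^0_3$ in $X$ for every ${\bf\Sigma}^0_2$ set $A\subseteq Y$ if and only if $f\in{\rm dec}({\bf\Sigma}^0_2,{\bf\Delta}^0_3)$.
   Context: $f\in{\rm dec}({\bf\Sigma}^0_2,{\bf\Delta}^0_3)$ means there is a partition $(X_k)_{k<\omega}$ of $X$ into countably many ${\bf\Delta}^0_3$ subsets of $X$ such that each $f\upharpoonright X_k$ is ${\bf\Sigma}^0_2$-measurable, i.e. $(f\upharpoonright X_k)^{-1}(U)$ is ${\bf\Sigma}^0_2$ in $X_k$ for every open $U\subseteq Y$. *)

(* Defs.v *)
From mathcomp Require Import all_boot all_order all_algebra.
From mathcomp Require Import all_classical all_reals.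
From mathcomp Require Import topology borel_hierarchy.

Set Implicit Arguments.
Unset Strict Implicit.
Unset Printing Implicit Defensive.

Local Open Scope classical_set_scope.

Definition homeomorphic (S T : topologicalType) : Prop :=
  exists (h : S -> T) (g : T -> S),
    [/\ cancel h g, cancel g h, continuous h & continuous g].

Definition separable (T : topologicalType) : Prop :=
  exists2 D : set T, countable D & dense D.

Definition metrizable (R : realType) (T : topologicalType) : Prop :=
  exists M : metricType R, homeomorphic T M.

(* The library's completeType only has pointed instances; completeness is
   restated here so that the empty space is Polish. *)
Definition complete_space (M : uniformType) : Prop :=
  forall F : set_system M, ProperFilter F -> cauchy F -> exists x : M, F --> x.

Definition completely_metrizable (R : realType) (T : topologicalType) : Prop :=
  exists2 M : metricType R, complete_space M & homeomorphic T M.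

Definition polish (R : realType) (T : topologicalType) : Prop :=
  separable T /\ completely_metrizable R T.

(* In metrizable spaces the pointclasses Sigma^0_2 and Pi^0_2 are the library's
   Fsigma and Gdelta. *)
Definition Sigma03 (T : topologicalType) (A : set T) : Prop :=
  exists2 F : nat -> set T, (forall i, Gdelta (F i)) & A = \bigcup_i F i.

Definition Delta03 (T : topologicalType) (A : set T) : Prop :=
  Sigma03 A /\ Sigma03 (~` A).

Definition Sigma02_measurable (T Y : topologicalType) (g : T -> Y) : Prop :=
  forall U : set Y, open U -> Fsigma (g @^-1` U).

(* sigL (P k) f is the restriction of f to the subtype of elements of P k, which
   carries the subspace topology.  Pieces may be empty, so that finite
   partitions are included. *)
Definition dec_Sigma02_Delta03 (X Y : topologicalType) (f : X -> Y) : Prop :=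
  exists P : nat -> set X,
    [/\ \bigcup_k P k = [set: X],
        trivIset [set: nat] P,
        forall k, Delta03 (P k) &
        forall k, Sigma02_measurable (sigL (P k) f)].

(* Main.v *)
(** Call A ⊆ X small if it is covered by countably many G_delta sets on each of
    which f is Sigma^0_2-measurable; f is decomposable iff X is small.  Assume that
    X is not small and that preimages of open sets are Sigma^0_3.  We build a tree
    of nodes r carrying a nonempty G_delta set G_r, a "reservoir" A_r and an open
    V_r ⊆ Y with f(G_r) ⊆ V_r, f(A_r) disjoint from the closure of every V_t chosen
    so far, the sets G and A of later descendants of r being contained in A_r, and
    children of r accumulating at each of their own descendants inside every open
    set containing G_r.  Along every infinite branch the nodes shrink to a point p
    with f(p) outside V = ⋃ V_r.  If f^-1(Y \ V) were a union of G_delta sets Q_n,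
    then by Baire category there would be s and n such that every node above s lies
    on a branch whose limit point is in Q_n; alternating between such branches and
    children of s would give a point of Q_n ∩ G_s, which f maps both outside and
    inside V.

    The extension step must choose a new V without exhausting the reservoirs of the
    finitely many existing nodes.  Reservoirs survive in the sense of iterated
    kernels [core], and a branch with n levels can be destroyed by at most n of
    several V's with disjoint closures ([core_apart]); if all choices of V failed,
    this bound would make the current reservoir small
    ([small_of_cover_bounded]). *)

Require Import Defs.
From mathcomp Require Import all_boot all_order all_algebra.
From mathcomp Require Import all_classical all_reals.
From mathcomp Require Import topology sequences borel_hierarchy.

Set Implicit Arguments.
Unset Strict Implicit.
Unset Printing Implicit Defensive.

Import Order.TTheory GRing.Theory Num.Theory.

Local Open Scope classical_set_scope.

Section pointclasses.
Context {T : topologicalType}.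
Implicit Types A B : set T.

Lemma Fsigma0 : Fsigma (set0 : set T).
Proof. exact/closed_Fsigma/closed0. Qed.

Lemma FsigmaT : Fsigma [set: T].
Proof. exact/closed_Fsigma/closedT. Qed.

Lemma Fsigma_bigcup (I : countType) (D : set I) (F : I -> set T) :
  (forall i, D i -> Fsigma (F i)) -> Fsigma (\bigcup_(i in D) F i).
Proof.
move=> FF.
have /choice[G GP] i : exists G : nat -> set T,
    (forall n, closed (G n)) /\ (D i -> F i = \bigcup_n G n).
  have [/FF[G cG ->]|nDi] := pselect (D i); first by exists G.
  by exists (fun=> set0); split=> // _; exact: closed0.
exists (fun n => if unpickle n is Some (i, m)
                 then if `[< D i >] then G i m else set0 else set0) => [n|].
  case: (unpickle n) => [[i m]|]; last exact: closed0.
  by case: ifP => _; [exact: (GP i).1|exact: closed0].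
apply/seteqP; split=> x.
- move=> [i Di]; rewrite ((GP i).2 Di) => -[m _ Gx].
  by exists (pickle (i, m)) => //; rewrite pickleK; case: asboolP.
- move=> [n _]; case: (unpickle n) => [[i m]|//].
  case: asboolP => // Di Gx; exists i => //.
  by rewrite ((GP i).2 Di); exists m.
Qed.

Lemma FsigmaU A B : Fsigma A -> Fsigma B -> Fsigma (A `|` B).
Proof.
move=> FA FB; rewrite -bigcup2E; by apply: Fsigma_bigcup => -[|[|n]] _ //=; exact: Fsigma0.
Qed.

Lemma FsigmaI A B : Fsigma A -> Fsigma B -> Fsigma (A `&` B).
Proof.
move=> [F cF ->] [G cG ->]; rewrite setI_bigcupl; apply: Fsigma_bigcup => i _.
rewrite setI_bigcupr; apply: Fsigma_bigcup => j _.
by apply: closed_Fsigma; exact: closedI.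
Qed.

Lemma GdeltaC A : Gdelta A <-> Fsigma (~` A).
Proof.
split=> [[O oO ->]|[F cF AF]].
  by exists (fun i => ~` O i); [move=> i; exact: open_closedC|rewrite setC_bigcap].
exists (fun i => ~` F i); first by move=> i; exact: closed_openC.
by rewrite -[LHS]setCK AF setC_bigcup.
Qed.

Lemma FsigmaC A : Fsigma A <-> Gdelta (~` A).
Proof. by rewrite GdeltaC setCK. Qed.

Lemma GdeltaI A B : Gdelta A -> Gdelta B -> Gdelta (A `&` B).
Proof. by rewrite !GdeltaC setCI; exact: FsigmaU. Qed.

Lemma Gdelta_Sigma03 A : Gdelta A -> Sigma03 A.
Proof. by exists (fun=> A) => //; rewrite bigcup_const. Qed.

Lemma open_Sigma03 A : open A -> Sigma03 A.
Proof. by move=> /open_Gdelta/Gdelta_Sigma03. Qed.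

Lemma Sigma03_bigcup (I : countType) (D : set I) (F : I -> set T) :
  (forall i, D i -> Sigma03 (F i)) -> Sigma03 (\bigcup_(i in D) F i).
Proof.
move=> FF.
have /choice[G GP] i : exists G : nat -> set T,
    (forall n, Gdelta (G n)) /\ (D i -> F i = \bigcup_n G n).
  have [/FF[G cG ->]|nDi] := pselect (D i); first by exists G.
  by exists (fun=> set0); split=> // _; exact/open_Gdelta/open0.
exists (fun n => if unpickle n is Some (i, m)
                 then if `[< D i >] then G i m else set0 else set0) => [n|].
  case: (unpickle n) => [[i m]|]; last exact/open_Gdelta/open0.
  by case: ifP => _; [exact: (GP i).1|exact/open_Gdelta/open0].
apply/seteqP; split=> x.
- move=> [i Di]; rewrite ((GP i).2 Di) => -[m _ Gx].
  by exists (pickle (i, m)) => //; rewrite pickleK; case: asboolP.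
- move=> [n _]; case: (unpickle n) => [[i m]|//].
  case: asboolP => // Di Gx; exists i => //.
  by rewrite ((GP i).2 Di); exists m.
Qed.

Lemma Sigma03I A B : Sigma03 A -> Sigma03 B -> Sigma03 (A `&` B).
Proof.
move=> [F cF ->] [G cG ->]; rewrite setI_bigcupl; apply: Sigma03_bigcup => i _.
rewrite setI_bigcupr; apply: Sigma03_bigcup => j _.
by apply: Gdelta_Sigma03; exact: GdeltaI.
Qed.

End pointclasses.

Definition regular_base (T : topologicalType) (b : nat -> set T) : Prop :=
  (forall n, open (b n)) /\
  (forall x U, open U -> U x -> exists n, b n x /\ closure (b n) `<=` U).

Section regular_base.
Context {T : topologicalType} (b : nat -> set T) (bP : regular_base b).
Implicit Types A : set T.

Lemma open_Fsigma A : open A -> Fsigma A.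
Proof.
move=> oA.
suff -> : A = \bigcup_(n in [set n | closure (b n) `<=` A]) closure (b n).
  by apply: Fsigma_bigcup => n _; exact/closed_Fsigma/closed_closure.
apply/seteqP; split=> [x Ax|x [n /= + bx]]; last exact.
have [n [bx bA]] := bP.2 _ _ oA Ax.
by exists n => //; exact: subset_closure.
Qed.

Lemma closed_Gdelta A : closed A -> Gdelta A.
Proof. by move=> cA; apply/GdeltaC/open_Fsigma/closed_openC. Qed.

Lemma closed_Sigma03 A : closed A -> Sigma03 A.
Proof. by move=> /closed_Gdelta/Gdelta_Sigma03. Qed.

Lemma Fsigma_Sigma03 A : Fsigma A -> Sigma03 A.
Proof. by move=> [F cF ->]; apply: Sigma03_bigcup => i _; exact: closed_Sigma03. Qed.

End regular_base.

Definition Sigma02_on (T Y : topologicalType) (f : T -> Y) (A : set T) : Prop :=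
  forall U, open U -> exists2 S, Fsigma S & A `&` f @^-1` U = A `&` S.

Definition small (T Y : topologicalType) (f : T -> Y) (A : set T) : Prop :=
  exists P : nat -> set T, [/\ forall k, Gdelta (P k),
    A `<=` \bigcup_k P k & forall k, Sigma02_on f (P k)].

Section small.
Context {T Y : topologicalType} {f : T -> Y}.
Implicit Types A B S G : set T.

Lemma Sigma02_onS A B : A `<=` B -> Sigma02_on f B -> Sigma02_on f A.
Proof.
move=> AB fB U /fB[S FS BS]; exists S => //.
by rewrite -(setIidl AB) -!setIA BS.
Qed.

Lemma smallS A B : A `<=` B -> small f B -> small f A.
Proof.
by move=> AB [P [GP BP fP]]; exists P; split=> //; exact: subset_trans BP.
Qed.

Lemma small0 : small f set0.
Proof.
exists (fun=> set0); split=> // [_|_ U oU]; first exact/open_Gdelta/open0.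
by exists set0; [exact: Fsigma0|rewrite !set0I].
Qed.

Lemma small_bigcup (I : countType) (D : set I) (F : I -> set T) :
  (forall i, D i -> small f (F i)) -> small f (\bigcup_(i in D) F i).
Proof.
move=> sF.
have /choice[P PP] i : exists P : nat -> set T, [/\ forall k, Gdelta (P k),
    D i -> F i `<=` \bigcup_k P k & forall k, Sigma02_on f (P k)].
  have [/sF[P [GP FP fP]]|nDi] := pselect (D i); first by exists P.
  exists (fun=> set0); split=> // [_|_ U oU]; first exact/open_Gdelta/open0.
  by exists set0; [exact: Fsigma0|rewrite !set0I].
exists (fun n => if unpickle n is Some (i, m) then P i m else set0); split.
- move=> n; case: unpickle => [[i m]|]; last exact/open_Gdelta/open0.
  by case: (PP i).
- move=> x [i Di Fx]; have [_ /(_ Di) /(_ _ Fx)[m _ Px] _] := PP i.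
  by exists (pickle (i, m)) => //; rewrite pickleK.
- move=> n; case: unpickle => [[i m]|]; first by case: (PP i).
  by move=> U oU; exists set0; [exact: Fsigma0|rewrite !set0I].
Qed.

Lemma smallU A B : small f A -> small f B -> small f (A `|` B).
Proof.
move=> sA sB; rewrite -bigcup2E.
by apply: small_bigcup => -[|[|n]] _ //=; exact: small0.
Qed.

Lemma small_Sigma03 A : Sigma03 A -> Sigma02_on f A -> small f A.
Proof.
move=> [P GP ->] fA; exists P; split=> // k.
by apply: Sigma02_onS fA => x Px; exists k.
Qed.

End small.

Definition negligible (T Y : topologicalType) (f : T -> Y) (A G : set T) : Prop :=
  exists S, [/\ Fsigma S, G `<=` S & small f (A `&` S)].

Definition kernel (T Y : topologicalType) (f : T -> Y) (A G : set T) : set T :=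
  [set x | forall U, open U -> U x -> ~ negligible f A (G `&` U)].

Section negligible.
Context {T Y : topologicalType} {f : T -> Y} (b : nat -> set T).
Hypothesis bP : regular_base b.
Implicit Types A B S G : set T.

Lemma negligibleS A B G H : A `<=` B -> G `<=` H ->
  negligible f B H -> negligible f A G.
Proof.
move=> AB GH [S [FS HS sS]]; exists S; split=> //; first exact: subset_trans HS.
by apply: smallS sS; exact: setSI.
Qed.

Lemma negligible_bigcup (I : countType) (D : set I) A (F : I -> set T) :
  (forall i, D i -> negligible f A (F i)) ->
  negligible f A (\bigcup_(i in D) F i).
Proof.
move=> nF.
have /choice[S SP] i : exists S, D i ->
    [/\ Fsigma S, F i `<=` S & small f (A `&` S)].
  have [/nF[S SP]|nDi] := pselect (D i); first by exists S.
  by exists set0.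
exists (\bigcup_(i in D) S i); split.
- by apply: Fsigma_bigcup => i /SP[].
- by move=> x [i Di Fx]; exists i => //; have [_ + _] := SP _ Di; exact.
- by rewrite setI_bigcupr; apply: small_bigcup => i /SP[].
Qed.

Lemma negligibleU A G H :
  negligible f A G -> negligible f A H -> negligible f A (G `|` H).
Proof.
move=> nG nH; rewrite -bigcup2E.
apply: negligible_bigcup => -[|[|n]] _ //=.
exists set0; split=> //; first exact: Fsigma0.
by rewrite setI0; exact: small0.
Qed.

Lemma closed_kernel A G : closed (kernel f A G).
Proof.
move=> x clx U oU Ux nG.
have [y [ky Uy]] := clx U (open_nbhs_nbhs (conj oU Ux)).
exact: ky oU Uy nG.
Qed.

Lemma kernel_closure A G : kernel f A G `<=` closure G.
Proof.
move=> x kx U; rewrite nbhsE => -[V [oV Vx] VU].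
apply: contrapT => /set0P/negP; rewrite negbK => /eqP GU.
apply: (kx V) => //; exists set0; split; first exact: Fsigma0.
- by rewrite -GU; exact: setIS.
- by rewrite setI0; exact: small0.
Qed.

Lemma negligible_kernel A G : negligible f A (G `\` kernel f A G).
Proof.
suff : negligible f A (\bigcup_(n in [set n | negligible f A (G `&` b n)])
                          (G `&` b n)).
  apply: negligibleS => // x [Gx] /existsNP[U /not_implyP[oU /not_implyP[Ux]]].
  move=> /contrapT nU; have [n [bx bU]] := bP.2 _ _ oU Ux.
  exists n => //=; apply: negligibleS nU => //; apply: setIS.
  exact: subset_trans (@subset_closure _ _) bU.
by apply: negligible_bigcup.
Qed.

End negligible.

Section covering.
Context {T Y : topologicalType} {f : T -> Y} (b : nat -> set T) (c : nat -> set Y).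
Hypotheses (bP : regular_base b) (cP : regular_base c).
Hypothesis f_open : forall U, open U -> Sigma03 (f @^-1` U).
Implicit Types A B S G : set T.

Definition apart (i j : nat) : Prop := closure (c i) `&` closure (c j) = set0.

Lemma Sigma03D A B : Sigma03 A -> Fsigma B -> Sigma03 (A `\` B).
Proof. by move=> sA /FsigmaC FB; apply: Sigma03I => //; exact: Gdelta_Sigma03. Qed.

Lemma Sigma03_diff_preimage A (C : set Y) : closed C -> Sigma03 A ->
  Sigma03 (A `\` f @^-1` C).
Proof.
by move=> cC sA; apply: Sigma03I => //; exact: f_open (closed_openC cC).
Qed.

Definition fine_cover (D : set nat) A : Prop := forall x U, A x -> open U -> U (f x) ->
  exists i, [/\ D i, c i (f x) & closure (c i) `<=` U].

Lemma small_of_cover A (D : set nat) (S : nat -> set T) : Sigma03 A ->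
  fine_cover D A -> (forall i, D i -> Fsigma (S i)) ->
  (forall i, D i -> A `&` f @^-1` c i `<=` S i) ->
  (forall i, D i -> small f (A `&` S i `\` f @^-1` closure (c i))) ->
  small f A.
Proof.
move=> sA fD FS AS sS.
(* Up to small sets, [A `&` S i] is mapped into [closure (c i)]; hence the overlap
   [X] of the [S i] with apart indices is small in [A], and outside [X] the
   [S i] compute preimages of open sets exactly. *)
pose X := \bigcup_(p in [set p : nat * nat | [/\ D p.1, D p.2 & apart p.1 p.2]])
  (S p.1 `&` S p.2).
have FX : Fsigma X.
  by apply: Fsigma_bigcup => -[i j] [Di Dj _]; apply: FsigmaI; exact: FS.
have sX : small f (A `&` X).
  rewrite setI_bigcupr; apply: small_bigcup => -[i j] /= [Di Dj ij].
  apply: smallS (smallU (sS i Di) (sS j Dj)) => x [Ax [Six Sjx]].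
  have [cx|cx] := pselect (closure (c i) (f x)); [right|by left].
  by split=> // cx'; have : set0 (f x) by rewrite -ij.
suff : small f (A `\` X).
  move=> sAX; apply: smallS (smallU sX sAX) => x Ax.
  by have [|] := pselect (X x); [left|right].
apply: small_Sigma03; first exact: Sigma03D.
move=> U oU; exists (\bigcup_(i in [set i | D i /\ closure (c i) `<=` U]) S i).
  by apply: Fsigma_bigcup => i [/FS].
apply/seteqP; split=> x [[Ax Xx]].
- move=> Ufx; split=> //; have [i [Di cx cU]] := fD _ _ Ax oU Ufx.
  by exists i => //; exact: AS.
- move=> [i [Di cU] Six]; split=> //; apply: contrapT => Ufx.
  have ncx : (~` closure (c i)) (f x) by move=> /cU.
  have [j [Dj cj cji]] := fD _ _ Ax (closed_openC (@closed_closure _ (c i))) ncx.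
  apply: Xx; exists (i, j) => /=; last by split=> //; exact: AS.
  by split=> //; rewrite /apart setIC; apply/disjoints_subset.
Qed.

(* Here the sets [S i] are allowed to miss part of [f @^-1` c i], as long as the
   missing part lies in sets [U i] of bounded multiplicity along pairwise apart
   indices.  Away from [f @^-1` closure (c i)] the multiplicity drops by one on
   [U i], so by induction [S i `|` U i] satisfies the hypotheses of
   [small_of_cover]. *)
Lemma small_of_cover_bounded n A (D : set nat) (S U : nat -> set T) :
  Sigma03 A -> fine_cover D A ->
  (forall i, D i -> Fsigma (S i)) -> (forall i, D i -> Fsigma (U i)) ->
  (forall i, D i -> A `&` f @^-1` c i `<=` S i `|` U i) ->
  (forall i, D i -> small f (A `&` S i `\` f @^-1` closure (c i))) ->
  (forall x s, A x -> pairwise (fun i j => `[< apart i j >]) s ->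
    (forall i, i \in s -> D i /\ U i x) -> (size s < n)%N) ->
  small f A.
Proof.
elim: n A D => [|n IHn] A D sA fD FS FU AS sS Un.
  suff -> : A = set0 by exact: small0.
  by rewrite -subset0 => x Ax; have /= : (0 < 0)%N by exact: (Un x [::]).
have sU i : D i -> small f (A `&` U i `\` f @^-1` closure (c i)).
  move=> Di; apply: (IHn _ [set j | D j /\ apart i j]) => //.
  - apply: Sigma03_diff_preimage; first exact: closed_closure.
    by apply: Sigma03I => //; apply: (Fsigma_Sigma03 bP); exact: FU.
  - move=> x V [[Ax Ux] cx] oV Vx.
    have [|//|j [Dj cj cV]] := fD x (V `\` closure (c i)) Ax.
      by apply: openI => //; exact/closed_openC/closed_closure.
    exists j; split=> //=; last by move=> y /cV[].
    split=> //; rewrite /apart setIC; apply/disjoints_subset => y /cV[].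
    by [].
  - by move=> j [/FS].
  - by move=> j [/FU].
  - by move=> j [Dj _] x [[[Ax _] _] cx]; exact: AS.
  - by move=> j [Dj _]; apply: smallS (sS j Dj) => x [[[[Ax _] _] Sx] cx].
  - move=> x s [[Ax Ux] _] ps sP.
    have /= := Un x (i :: s) Ax; rewrite ltnS; apply.
      by rewrite ps andbT; apply/allP => j /sP[[_ ij] _]; exact/asboolP.
    by move=> j; rewrite inE => /orP[/eqP ->//|/sP[[]]].
apply: (small_of_cover sA fD (S := fun i => S i `|` U i)) => //.
- by move=> i Di; apply: FsigmaU; [exact: FS|exact: FU].
- move=> i Di; apply: smallS (smallU (sS i Di) (sU i Di)) => x [[Ax [Sx|Ux]] cx].
    by left.
  by right.
Qed.

End covering.

(* [l] lists the pairs (generic set, reservoir) along a branch of the tree, from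
   the leaf to the root; [W] is the part of Y that has to be avoided. *)
Definition core (T Y : topologicalType) (f : T -> Y) (W : set Y)
    (l : seq (set T * set T)) : set T :=
  foldr (fun p C => kernel f (p.2 `\` f @^-1` W) (p.1 `&` C)) setT l.

Section core.
Context {T Y : topologicalType} {f : T -> Y} (b : nat -> set T) (c : nat -> set Y).
Hypotheses (bP : regular_base b) (cP : regular_base c).
Hypothesis f_open : forall U, open U -> Sigma03 (f @^-1` U).
Implicit Types (A G : set T) (W : set Y) (l : seq (set T * set T)).

Lemma closed_core W l : closed (core f W l).
Proof. by case: l => [|p l] /=; [exact: closedT|exact: closed_kernel]. Qed.

Lemma core_catS W l1 l2 : core f W (l1 ++ l2) `<=` core f W l2.
Proof.
elim: l1 => [//|p l1 IH] x /= /kernel_closure px; apply: (@closed_core W).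
by apply: closureS px => y [_ /IH].
Qed.

Lemma open_nbhs_seq (x : T) (Q : nat -> set T -> Prop) (s : seq nat) :
  (forall i U V, U `<=` V -> Q i V -> Q i U) ->
  (forall i, i \in s -> exists U, [/\ open U, U x & Q i U]) ->
  exists U, [/\ open U, U x & forall i, i \in s -> Q i U].
Proof.
move=> QS; elim: s => [_|i s IH sQ].
  by exists setT; split=> //; exact: openT.
have [|U [oU Ux QU]] := IH; first by move=> j js; apply: sQ; rewrite inE js orbT.
have [|V [oV Vx QV]] := sQ i; first exact: mem_head.
exists (U `&` V); split=> //; first exact: openI.
move=> j; rewrite inE => /orP[/eqP ->|/QU].
  by apply: QS QV; exact: subIsetr.
by apply: QS; exact: subIsetl.
Qed.

Lemma size_filter_split (T' : Type) (a : pred T') (s : seq T') :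
  size s = (size [seq i <- s | a i] + size [seq i <- s | predC a i])%N.
Proof. by rewrite !size_filter count_predC. Qed.

(* A point of G in all but [size l] of the smaller cores lies in two of the
   witnessing F_sigma sets, and the reservoir is covered by the two reservoirs
   avoiding the disjoint sets [E i] and [E j]. *)
Lemma core_apart W l (E : nat -> set Y) (s : seq nat) (x : T) :
  core f W l x -> pairwise (fun i j => `[< E i `&` E j = set0 >]) s ->
  (forall i, i \in s -> ~ core f (W `|` E i) l x) -> (size s <= size l)%N.
Proof.
elim: l s x => [|[G A] l IH] s x.
  by case: s => // i s _ _ /(_ i (mem_head _ _)) /=; case.
move=> /= xl ps sE; rewrite leqNgt; apply/negP => ls.
pose N i := negligible f (A `\` f @^-1` (W `|` E i)).
pose C i := core f (W `|` E i) l.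
have [|i /sE|U [oU Ux QU]] :=
    @open_nbhs_seq x (fun i U => N i (G `&` C i `&` U)) s.
- by move=> i U V UV; apply: negligibleS => //; exact: setIS.
- move=> /existsNP[U /not_implyP[oU /not_implyP[Ux]]] /contrapT nU.
  by exists U.
have /choice[S SP] i : exists S, i \in s ->
    [/\ Fsigma S, G `&` C i `&` U `<=` S &
        small f ((A `\` f @^-1` (W `|` E i)) `&` S)].
  have [/QU[S SP]|] := boolP (i \in s); first by exists S.
  by exists set0.
apply: (xl U oU Ux).
exists (\bigcup_(p in [set p : nat * nat |
   [/\ p.1 \in s, p.2 \in s & E p.1 `&` E p.2 = set0]]) (S p.1 `&` S p.2)); split.
- apply: Fsigma_bigcup => -[i j] /= [/SP[Si _ _] /SP[Sj _ _] _].
  exact: FsigmaI.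
- move=> z [[Gz lz] Uz].
  pose a i := `[< C i z >].
  have psa : pairwise (fun i j => `[< E i `&` E j = set0 >]) [seq i <- s | a i].
    by apply: subseq_pairwise ps; exact: filter_subseq.
  have sNa : (size [seq i <- s | predC a i] <= size l)%N.
    apply: (IH _ z) => //.
      by apply: subseq_pairwise ps; exact: filter_subseq.
    by move=> i; rewrite mem_filter => /andP[/asboolPn].
  have sa : (1 < size [seq i <- s | a i])%N.
    rewrite -(ltn_add2r (size [seq i <- s | predC a i])) -size_filter_split.
    by apply: leq_ltn_trans ls; rewrite add1n.
  have aP i : i \in [seq i <- s | a i] -> i \in s /\ S i z.
    rewrite mem_filter => /andP[/asboolP Ciz si]; split=> //.
    by have [_ + _] := SP _ si; apply; exact: (conj (conj Gz Ciz) Uz).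
  case: [seq i <- s | a i] sa psa aP => [//|i [//|j s']] _ /= /andP[/andP[/asboolP ij _] _] aP.
  have [si Siz] := aP i (mem_head _ _).
  have [|sj Sjz] := aP j; first by rewrite !inE eqxx orbT.
  by exists (i, j).
- rewrite setI_bigcupr; apply: small_bigcup => -[i j] /= [/SP[_ _ Si] /SP[_ _ Sj] ij].
  apply: smallS (smallU Si Sj) => z [[Az Wz] [Siz Sjz]].
  have [Ei|Ei] := pselect (E i (f z)).
    right; split=> //; split=> // -[//|Ej].
    by have : set0 (f z) by rewrite -ij.
  by left; split=> //; split=> // -[].
Qed.

Lemma core_apart_family W (E : nat -> set Y) (y : nat -> T)
    (l : nat -> seq (set T * set T)) N (s : seq nat) :
  (forall k, (k < N)%N -> core f W (l k) (y k)) ->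
  pairwise (fun i j => `[< E i `&` E j = set0 >]) s ->
  (forall i, i \in s -> exists2 k, (k < N)%N & ~ core f (W `|` E i) (l k) (y k)) ->
  (size s <= \sum_(k < N) size (l k))%N.
Proof.
elim: N s => [|N IH] s yl ps sE.
  by case: s ps sE => // i s _ /(_ i (mem_head _ _)) [].
rewrite big_ord_recr /= addnC.
pose a i := `[< ~ core f (W `|` E i) (l N) (y N) >].
rewrite (size_filter_split a); apply: leq_add.
  apply: (core_apart (yl N _)) => //.
    by apply: subseq_pairwise ps; exact: filter_subseq.
  by move=> i; rewrite mem_filter => /andP[/asboolP].
apply: IH.
- by move=> k kN; apply: yl; exact: ltnW.
- by apply: subseq_pairwise ps; exact: filter_subseq.
- move=> i; rewrite mem_filter => /andP[/asboolPn/contrapT ai /sE[k + nk]].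
  rewrite ltnS leq_eqVlt => /orP[/eqP kN|kN]; last by exists k.
  by rewrite kN in nk.
Qed.

Lemma core_extend W A (l0 : seq (set T * set T)) (y : nat -> T)
    (l : nat -> seq (set T * set T)) N :
  closed W -> Gdelta A -> ~ small f A -> A `<=` core f W l0 ->
  A `&` f @^-1` W = set0 ->
  (forall k, (k < N)%N -> core f W (l k) (y k)) ->
  exists i G, [/\ Gdelta G, G `<=` A `&` f @^-1` c i,
    core f (W `|` closure (c i)) ((G, A) :: l0) !=set0 &
    forall k, (k < N)%N -> core f (W `|` closure (c i)) (l k) (y k)].
Proof.
move=> cW GA nA Al0 AW yl; apply: contrapT => nE; apply: nA.
pose C i := closure (c i).
pose killed i := exists2 k, (k < N)%N & ~ core f (W `|` C i) (l k) (y k).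
have sA i : Sigma03 (A `&` f @^-1` c i).
  by apply: Sigma03I; [exact: Gdelta_Sigma03|exact/f_open/(cP.1 i)].
have /choice[S SP] i : exists S, [/\ Fsigma S,
    ~ killed i -> A `&` f @^-1` c i `&` core f (W `|` C i) l0 `<=` S &
    small f (A `&` S `\` f @^-1` C i)].
  have [ki|nki] := pselect (killed i).
    exists set0; split=> //; first exact: Fsigma0.
    by rewrite setI0 set0D; exact: small0.
  have [G GG AG] := sA i.
  have [S [FS GS sS]] :
      negligible f (A `\` f @^-1` (W `|` C i))
        (\bigcup_n (G n `&` core f (W `|` C i) l0)).
    apply: negligible_bigcup => n _.
    suff K0 : core f (W `|` C i) ((G n, A) :: l0) = set0.
      have := @negligible_kernel _ _ f _ bP (A `\` f @^-1` (W `|` C i))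
        (G n `&` core f (W `|` C i) l0).
      by rewrite [kernel _ _ _]K0 setD0.
    rewrite -subset0 => z zK; apply: nE; exists i, (G n); split=> //.
    - by rewrite AG => x Gx; exists n.
    - by exists z.
    - move=> k kN; apply: contrapT => nk; apply: nki; by exists k.
  exists S; split=> //.
    by move=> _; rewrite AG setI_bigcupl.
  apply: smallS sS => x [[Ax Sx] cx]; split=> //; split=> // -[Wx|//].
  by have : set0 x by rewrite -AW.
pose U i := if `[< killed i >] then setT else ~` core f (W `|` C i) l0.
have fA : fine_cover (f := f) c setT A.
  move=> x V Ax oV Vx; have [i [ci cV]] := cP.2 _ _ oV Vx.
  by exists i.
apply: (@small_of_cover_bounded _ _ f _ c bP f_open
  (size l0 + \sum_(k < N) size (l k)).+1 A setT S U) => //.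
- exact: Gdelta_Sigma03.
- by move=> i _; have [] := SP i.
- move=> i _; rewrite /U; case: ifP => _; first exact: FsigmaT.
  exact: (open_Fsigma bP) (closed_openC (@closed_core _ _)).
- move=> i _ x Ax; rewrite /U; case: asboolP => ki; first by right.
  have [xC|xC] := pselect (core f (W `|` C i) l0 x); last by right.
  by left; have [_ + _] := SP i; apply.
- by move=> i _; have [] := SP i.
- move=> x s Ax ps sU; rewrite ltnS.
  pose a i := `[< ~ core f (W `|` C i) l0 x >].
  rewrite (size_filter_split a); apply: leq_add.
    apply: (core_apart (E := C) (Al0 _ Ax)).
      by apply: subseq_pairwise ps; exact: filter_subseq.
    by move=> i; rewrite mem_filter => /andP[/asboolP].
  apply: (core_apart_family yl (E := C)).
    by apply: subseq_pairwise ps; exact: filter_subseq.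
  move=> i; rewrite mem_filter => /andP[/asboolPn/contrapT ai /sU[_]].
  by rewrite /U; case: asboolP.
Qed.

End core.

Lemma indexed_dependent_choice (I : Type) (Inv : nat -> I -> Prop)
    (R : nat -> I -> I -> Prop) (x0 : I) : Inv 0%N x0 ->
  (forall n x, Inv n x -> exists y, R n x y /\ Inv n.+1 y) ->
  exists e : nat -> I,
    [/\ e 0%N = x0, forall n, Inv n (e n) & forall n, R n (e n) (e n.+1)].
Proof.
move=> I0 IR.
have /choice[F FP] (p : nat * I) : exists y, Inv p.1 p.2 ->
    R p.1 p.2 y /\ Inv p.1.+1 y.
  have [/IR[y yP]|nI] := pselect (Inv p.1 p.2); first by exists y.
  by exists x0.
pose e := fix e n := if n is n'.+1 then F (n', e n') else x0.
have eI n : Inv n (e n) by elim: n => // n /(FP (n, e n))[].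
by exists e; split=> // n; have [] := FP (n, e n) (eI n).
Qed.

Definition truncate (I : Type) (x0 : I) (n : nat) (e : nat -> I) : nat -> I :=
  fun j => if (j < n)%N then e j else x0.

Lemma strong_dependent_choice (I : Type) (x0 : I)
    (P : nat -> (nat -> I) -> I -> Prop) :
  (forall n e, (forall j, (j < n)%N -> P j (truncate x0 j e) (e j)) ->
    exists x, P n (truncate x0 n e) x) ->
  exists e, forall n, P n (truncate x0 n e) (e n).
Proof.
move=> Px.
pose Inv n (e : nat -> I) := forall j, (j < n)%N -> P j (truncate x0 j e) (e j).
have tr_eq n (e e' : nat -> I) : (forall j, (j < n)%N -> e j = e' j) ->
    truncate x0 n e = truncate x0 n e'.
  by move=> ee'; apply/funext => j; rewrite /truncate; case: ifP => // /ee'.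
have [||E [_ EI ER]] := @indexed_dependent_choice _ Inv
    (fun n e e' => forall j, (j < n)%N -> e' j = e j) (fun=> x0).
- by [].
- move=> n e eI; have [x xP] := Px n e eI.
  exists (fun j => if (j < n)%N then e j else x); split=> [j -> //|j].
  rewrite ltnS => jn.
  rewrite (_ : truncate _ _ _ = truncate x0 j e); last first.
    by apply: tr_eq => i ij; rewrite (leq_trans ij jn).
  case: ltnP => [/eI//|nj].
  by rewrite (_ : j = n) //; apply/eqP; rewrite eqn_leq jn.
- have Elt n m j : (j < n)%N -> (n <= m)%N -> E m j = E n j.
    move=> jn; elim: m => [|m IH]; first by rewrite leqn0 => /eqP ->.
    rewrite leq_eqVlt => /orP[/eqP -> //|]; rewrite ltnS => nm.
    by rewrite ER ?IH //; exact: leq_trans nm.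
  exists (fun j => E j.+1 j) => n.
  rewrite (_ : truncate _ _ _ = truncate x0 n (E n.+1)); first exact: EI.
  by apply: tr_eq => j jn; rewrite (Elt j.+1 n.+1) // ltnW.
Qed.

Lemma infinitely_repeating_pairs : exists dec : nat -> nat * nat,
  forall p N, exists2 n, (N <= n)%N & dec n = p.
Proof.
exists (fun n => (logn 2 n, logn 3 n)) => -[i j] N.
exists (2 ^ i * 3 ^ j * 5 ^ N)%N.
  apply: leq_trans (ltnW (ltn_expl N (isT : 1 < 5)%N)) _.
  by rewrite leq_pmull // muln_gt0 !expn_gt0.
by rewrite !lognM ?muln_gt0 ?expn_gt0 // !lognX !logn_prime //= !muln0 !muln1 ?addn0.
Qed.

Lemma open_bigcap_lt (T : topologicalType) n (F : nat -> set T) :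
  (forall i, open (F i)) -> open (\bigcap_(i in `I_n) F i).
Proof.
move=> oF; rewrite -[X in open X]setCK openC setC_bigcap.
by apply: closed_bigcup => [|i _]; [exact: finite_II|exact: open_closedC].
Qed.

(* A level stores the open sets whose intersections are the generic set [Gen] and
   the reservoir [Res]; a node of the tree is the list of the levels on its branch,
   leaf first.  [res d 0] also serves as a neighbourhood localising the node. *)
Record level (T : Type) := Level { gen : nat -> set T; res : nat -> set T }.
Definition Gen (T : Type) (d : level T) : set T := \bigcap_m gen d m.
Definition Res (T : Type) (d : level T) : set T := \bigcap_m res d m.
Definition chain (T : Type) (w : seq (level T)) := [seq (Gen d, Res d) | d <- w].
Definition level0 (T : Type) : level T := Level (fun=> setT) (fun=> setT).
Definition top (T : Type) (w : seq (level T)) : level T := nth (level0 T) w 0.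

Record node (T : Type) :=
  Node { levels : seq (level T); witness : T; target : nat }.

Section construction.
Context {R : realType} {T : pseudoMetricType R} {Y : topologicalType} {f : T -> Y}.
Variables (b : nat -> set T) (c : nat -> set Y).
Hypotheses (bP : regular_base b) (cP : regular_base c).
Hypothesis f_open : forall U, open U -> Sigma03 (f @^-1` U).

Definition hit n (e : nat -> node T) : set Y :=
  \bigcup_(j in `I_n) closure (c (target (e j))).

(* [e] enumerates the nodes in order of creation; only [e j] for [j < n] matters
   for [sound n e] and for [child n e x p]. *)
Definition sound n (e : nat -> node T) (x : node T) : Prop :=
  [/\ all (fun d => `[< forall m, open (gen d m) /\ open (res d m) >]) (levels x),
      pairwise (fun d d' => `[< Res d `<=` Res d' >]) (levels x),
      (0 < size (levels x))%N,
      closure (res (top (levels x)) 0) (witness x) &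
      [/\ Gen (top (levels x)) `<=` f @^-1` c (target x),
      Res (top (levels x)) `&` f @^-1` hit n e = set0,
      core f (hit n e `|` closure (c (target x))) (chain (levels x)) (witness x) &
      forall j, (j < n)%N -> core f (hit n e `|` closure (c (target x)))
        (chain (levels (e j))) (witness (e j))]].

(* [x] is a child of the ancestor, [p.2] levels up, of the node [e p.1], and it is
   placed near the witness of [e p.1]. *)
Definition child n (e : nat -> node T) (x : node T) (p : nat * nat) : Prop :=
  let w := drop p.2 (levels (e p.1)) in
  exists d, [/\ levels x = d :: w,
    closure (res d 0) `<=` ball (witness (e p.1)) n.+1%:R^-1%R,
    forall i m, (i < size w)%N -> (m <= n)%N ->
      closure (res d 0) `<=` res (nth (level0 T) w i) m &
    forall m, (m <= n)%N -> closure (res d 0) `<=` gen (top w) m].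

Definition valid n (e : nat -> node T) (p : nat * nat) : bool :=
  (p.1 < n)%N && (p.2 < size (levels (e p.1)))%N.

Lemma closed_hit n e : closed (hit n e).
Proof.
by apply: closed_bigcup => [|i _]; [exact: finite_II|exact: closed_closure].
Qed.

Lemma sound_extend n (e : nat -> node T) (w : seq (level T)) (A B : set T) :
  all (fun d => `[< forall m, open (gen d m) /\ open (res d m) >]) w ->
  pairwise (fun d d' => `[< Res d `<=` Res d' >]) w ->
  all (fun d => `[< A `<=` Res d >]) w ->
  open B -> A `<=` B -> Gdelta A -> ~ small f A ->
  A `<=` core f (hit n e) (chain w) -> A `&` f @^-1` hit n e = set0 ->
  (forall j, (j < n)%N -> core f (hit n e) (chain (levels (e j))) (witness (e j))) ->
  exists x d, [/\ sound n e x, levels x = d :: w & res d 0 = B].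
Proof.
move=> ow pw Aw oB AB [F oF AF] nA Ac AW ec.
have [|i [G [[O oO GO] GA [y yG] ei]]] := core_extend bP cP f_open
  (l := fun j => chain (levels (e j))) (y := fun j => witness (e j)) (N := n)
  (@closed_hit n e) _ nA Ac AW ec; first by exists F.
pose H m := if m is m'.+1 then F m' else B.
have HA : \bigcap_m H m = A.
  apply/seteqP; split=> [x Hx|x Ax [|m] _ /=]; last 2 first.
  - exact: AB.
  - by move: Ax; rewrite AF; exact.
  by rewrite AF => m _; exact: (Hx m.+1).
pose d := Level O H.
exists (Node (d :: w) y i), d; split=> //; split=> //=.
- rewrite ow andbT; apply/asboolP => m; split; first exact: oO.
  by case: m.
- rewrite pw andbT; apply: sub_all Aw => t /asboolP At; apply/asboolP.
  by rewrite /Res HA.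
- apply: (closureS (A := G)); first by move=> x /GA[/AB].
  by apply: closureS (kernel_closure yG); exact: subIsetl.
- rewrite /top /= {1}/Gen {1}/Res /= HA -GO; split=> //.
    by move=> x /GA[].
  by rewrite /Gen /Res /= HA -GO.
Qed.

Lemma child_exists n (e : nat -> node T) (p : nat * nat) :
  (forall j, (j < n)%N -> sound j e (e j)) -> valid n e p ->
  exists x, sound n e x /\ child n e x p.
Proof.
case: p => i j /= es /andP[/= ltin ltj].
have eC k : (k < n)%N -> core f (hit n e) (chain (levels (e k))) (witness (e k)).
  move=> kn; case: n {ltin} kn es => // n kn es.
  have -> : hit n.+1 e = hit n e `|` closure (c (target (e n))).
    by rewrite /hit IIS bigcup_setU bigcup_set1.
  have [_ _ _ _ [_ _ en ekn]] := es n (ltnSn n).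
  move: kn; rewrite ltnS leq_eqVlt => /orP[/eqP ->//|]; exact: ekn.
have [ow pw _ _ _] := es i ltin.
have [t [w defw]] : exists t w, drop j (levels (e i)) = t :: w.
  have := size_drop j (levels (e i)); case: (drop _ _) => [|t w _]; last first.
    by exists t; exists w.
  by move=> /esym/eqP; rewrite subn_eq0 leqNgt ltj.
have {}ow : all (fun d => `[< forall m, open (gen d m) /\ open (res d m) >]) (t :: w).
  by move: ow; rewrite -(cat_take_drop j (levels (e i))) all_cat defw => /andP[].
have {}pw : pairwise (fun d d' => `[< Res d `<=` Res d' >]) (t :: w).
  move: pw; rewrite -(cat_take_drop j (levels (e i))) pairwise_cat defw.
  by move=> /and3P[].
have oP k m : (k < size (t :: w))%N ->
    open (gen (nth (level0 T) (t :: w) k) m) /\ open (res (nth (level0 T) (t :: w) k) m).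
  by move=> ks; have /(all_nthP (level0 T))/(_ k ks)/asboolP := ow; exact.
have yw : core f (hit n e) (chain (t :: w)) (witness (e i)).
  apply: (@core_catS _ _ _ _ (chain (take j (levels (e i))))).
  by rewrite -map_cat -defw cat_take_drop; exact: eC.
pose rad : R := (n.+1%:R^-1)%R.
have rad0 : (0 < rad)%R by rewrite invr_gt0 ltr0n.
pose V := (ball (witness (e i)) rad)°.
have Vy : V (witness (e i)) by exact: (nbhsx_ballx _ _ rad0).
pose OO := \bigcap_(m in `I_n.+1) gen t m.
have oOO : open OO.
  by apply: open_bigcap_lt => m; exact: (oP 0%N m _).1.
pose HH := \bigcap_(k in `I_(size (t :: w)))
  \bigcap_(m in `I_n.+1) (if (k < size (t :: w))%N then res (nth (level0 T) (t :: w) k) m else setT).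
have oHH : open HH.
  apply: open_bigcap_lt => k; apply: open_bigcap_lt => m.
  by case: ifP => [ks|_]; [exact: (oP k m ks).2|exact: openT].
pose K := core f (hit n e) (chain (t :: w)).
pose A1 := (Res t `\` f @^-1` hit n e) `&` (K `&` OO `&` V).
have A1HH : A1 `<=` HH.
  move=> x [[tx _] _] k ks m _; rewrite ks.
  case: k ks => [|k] /= ks; first exact: tx.
  move: pw => /= /andP[/(all_nthP (level0 T))/(_ k ks)/asboolP tk _].
  exact: tk.
have nA1 : ~ small f A1.
  move=> sA1; have := yw; rewrite /= => /(_ V (@open_interior _ _) Vy); apply.
  set C := core f (hit n e) _; set A := Res t `\` _.
  apply: (@negligibleS _ _ f A A _
      ((K `&` OO `&` V) `|` ((Gen t `&` C) `\` kernel f A (Gen t `&` C)))) => //.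
    move=> x [[Gx Cx] Vx].
    have [Kx|Kx] := pselect (kernel f A (Gen t `&` C) x); last by right.
    by left; split=> //; split=> [|m _]; [exact: Kx|exact: Gx].
  apply: negligibleU; last exact: (negligible_kernel bP).
  exists (K `&` OO `&` V); split=> //.
  apply: FsigmaI; last exact/(open_Fsigma bP)/open_interior.
  apply: FsigmaI; last exact/(open_Fsigma bP).
  exact/closed_Fsigma/closed_core.
have sA1 : Sigma03 A1.
  apply: Sigma03I.
    apply: (Sigma03_diff_preimage f_open); first exact: closed_hit.
    by apply: Gdelta_Sigma03; exists (res t) => // m; exact: (oP 0%N m _).2.
  apply: Sigma03I; last exact/open_Sigma03/open_interior.
  apply: Sigma03I; last exact/open_Sigma03.
  exact/(closed_Sigma03 bP)/closed_core.
pose N := OO `&` V `&` HH.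
have oN : open N by apply: openI => //; apply: openI => //; exact: open_interior.
have [k [bN nAk]] : exists k, closure (b k) `<=` N /\ ~ small f (A1 `&` b k).
  apply: contrapT => nk; apply: nA1.
  apply: (@smallS _ _ f _ (\bigcup_(k in [set k | closure (b k) `<=` N]) (A1 `&` b k))).
    move=> x Ax; have [|k [bx bN]] := bP.2 x N oN.
      by split; [case: Ax => _ [[_ ?] ?]|exact: A1HH].
    by exists k.
  apply: small_bigcup => k bN; apply: contrapT => sk; apply: nk; by exists k.
have [P GP defP] : Sigma03 (A1 `&` b k).
  by apply: Sigma03I => //; exact/open_Sigma03/(bP.1 k).
have [q nq] : exists q, ~ small f (P q).
  apply: contrapT => nq; apply: nAk; rewrite defP; apply: small_bigcup => q _.
  by apply: contrapT => sq; apply: nq; exists q.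
have PA1 : P q `<=` A1 `&` b k by rewrite defP => x Px; exists q.
have [||||||||||x [d [sx px dB]]] := @sound_extend n e (t :: w) (P q) (b k) => //.
- rewrite /=; apply/andP; split.
    by apply/asboolP => x /PA1[[[]]].
  apply/(all_nthP (level0 T)) => l ls; apply/asboolP => x /PA1[[[tx _] _] _].
  by move: pw => /= /andP[/(all_nthP (level0 T))/(_ l ls)/asboolP + _]; apply.
- exact: (bP.1 k).
- by move=> x /PA1[].
- by move=> x /PA1[[_ [[]]]].
- by rewrite -subset0 => x [/PA1[[[_ nx] _] _]].
exists x; split=> //; rewrite /child /= defw; exists d; split=> //; rewrite dB.
- by move=> z /bN[[_ /interior_subset]].
- move=> l m ls mn z /bN[_ /(_ l ls m)] /=.
  by rewrite ls; apply.
- by move=> m mn z /bN[[/(_ m mn)]].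
Qed.

End construction.

(* The nodes of the tree are numbered; [H k] and [O k] are the open sets defining
   the reservoir and the generic set of node [k], and [ext k k'] says that [k'] is a
   proper descendant of [k]. *)
Record scheme (R : realType) (T : pseudoMetricType R) (Y : topologicalType)
    (f : T -> Y) (H O : nat -> nat -> set T) (V : nat -> set Y) (y : nat -> T)
    (ext : nat -> nat -> Prop) : Prop := {
  scheme_openH : forall k m, open (H k m);
  scheme_openO : forall k m, open (O k m);
  scheme_trans : forall k1 k2 k3, ext k1 k2 -> ext k2 k3 -> ext k1 k3;
  scheme_lt : forall k k', ext k k' -> (k < k')%N;
  scheme_nested : forall k k' m, ext k k' -> (m <= k')%N ->
    closure (H k' 0%N) `<=` H k m;
  scheme_point : forall k, closure (H k 0%N) (y k);
  scheme_radius : forall k, (0 < k)%N ->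
    exists z, closure (H k 0%N) `<=` ball z k.+1%:R^-1%R;
  scheme_generic : forall k, \bigcap_m O k m `<=` f @^-1` V k;
  scheme_avoid : forall k k', (k < k')%N ->
    \bigcap_m H k' m `&` f @^-1` V k = set0;
  scheme_dense : forall s u N, s = u \/ ext s u -> exists k,
    [/\ (N <= k)%N, ext s k, closure (H k 0%N) `<=` ball (y u) N.+1%:R^-1%R &
        forall m, (m <= N)%N -> closure (H k 0%N) `<=` O s m] }.

Section scheme_existence.
Context {R : realType} {T : pseudoMetricType R} {Y : topologicalType} {f : T -> Y}.
Variables (b : nat -> set T) (c : nat -> set Y).
Hypotheses (bP : regular_base b) (cP : regular_base c).
Hypothesis f_open : forall U, open U -> Sigma03 (f @^-1` U).

Lemma sound_truncate x0 n (e : nat -> node T) x :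
  sound (f := f) c n (truncate x0 n e) x <-> sound (f := f) c n e x.
Proof.
have tr j : (j < n)%N -> truncate x0 n e j = e j by rewrite /truncate => ->.
have -> : sound (f := f) c n (truncate x0 n e) x = sound (f := f) c n e x; last by [].
rewrite /sound.
have -> : hit c n (truncate x0 n e) = hit c n e.
  by apply: eq_bigcupr => j jn; rewrite tr.
congr (and5 _ _ _ _ (and4 _ _ _ _)); apply/propext.
by split=> + j jn => /(_ j jn); rewrite tr.
Qed.

Lemma nodes_exist (dec : nat -> nat * nat) : ~ small f setT ->
  exists e : nat -> node T, forall n, sound (f := f) c n e (e n) /\
    ((0 < n)%N -> exists p, [/\ valid n e p, valid n e (dec n) -> p = dec n &
      child n e (e n) p]).
Proof.
move=> nT.
pose P n (e : nat -> node T) x := sound (f := f) c n e x /\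
  ((0 < n)%N -> exists p, [/\ valid n e p, valid n e (dec n) -> p = dec n &
      child n e x p]).
have [x0 _] : exists x0 : node T, True.
  have [[y _]|nz] := pselect (exists y : T, True); first by exists (Node [::] y 0).
  exfalso; apply: nT; suff -> : [set: T] = set0 by exact: small0.
  by rewrite -subset0 => y _; apply: nz; exists y.
have [|e eP] := @strong_dependent_choice _ x0 P; last first.
  exists e => n; have [sn cn] := eP n; split; first exact/(sound_truncate x0).
  have tr j : (j < n)%N -> truncate x0 n e j = e j by rewrite /truncate => ->.
  have vE p : valid n (truncate x0 n e) p = valid n e p.
    by rewrite /valid; case: ltnP => //= /tr ->.
  move=> /cn[p []]; rewrite !vE => vp dp cp; exists p; split=> //.
  by move: cp; rewrite /child tr //; case/andP: vp.
move=> n e eP; set e' := truncate x0 n e.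
have es j : (j < n)%N -> sound (f := f) c j e' (e' j).
  move=> jn; have [+ _] := eP j jn; rewrite {2}/e' {2}/truncate jn.
  rewrite !sound_truncate => sj; apply/(sound_truncate x0).
  rewrite (_ : truncate _ _ _ = truncate x0 j e); first exact/sound_truncate.
  apply/funext => i; rewrite /e' /truncate; case: ifP => // ij.
  by rewrite (ltn_trans ij jn).
have [n0|n0] := posnP n.
  have [||||||||||x [d [sx _ _]]] := @sound_extend _ _ _ f _ _ bP cP f_open n e'
    [::] setT setT => //.
  - exact: openT.
  - exact/open_Gdelta/openT.
  - by rewrite n0 /hit II0 bigcup_set0 preimage_set0 setI0.
  - by move=> j; rewrite n0.
  by exists x; split=> //; rewrite n0.
pose p := if valid n e' (dec n) then dec n else (0%N, 0%N).
have vp : valid n e' p.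
  rewrite /p; case: ifP => // _; rewrite /valid /= n0 /=.
  by have [_ _] := es 0%N n0.
have [x [sx cx]] := child_exists bP cP f_open es vp.
exists x; split=> // _; exists p; split=> //.
by rewrite /p => ->.
Qed.

Lemma scheme_exists : ~ small f setT -> exists H O v y ext,
  @scheme R T Y f H O (fun k => c (v k)) y ext.
Proof.
have [dec decP] := infinitely_repeating_pairs.
move=> /(nodes_exist dec)[e eP].
pose t k := top (levels (e k)).
pose ext k k' := (k < k')%N /\ exists2 l, (0 < size l)%N &
  levels (e k') = l ++ levels (e k).
exists (fun k => res (t k)), (fun k => gen (t k)), (fun k => target (e k)),
  (fun k => witness (e k)), ext.
have nonempty k : (0 < size (levels (e k)))%N by have [[]] := eP k.
have topP k : exists w, levels (e k) = t k :: w.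
  rewrite /t; case: (levels (e k)) (nonempty k) => // d w _.
  by exists w.
have opens k m : open (gen (t k) m) /\ open (res (t k) m).
  have [[ow _ _ _ _] _] := eP k; have [w ew] := topP k.
  by move: ow; rewrite ew /= => /andP[/asboolP + _]; exact.
have childP k : (0 < k)%N -> exists p w, [/\ levels (e k) = t k :: w,
    valid k e p /\ (valid k e (dec k) -> p = dec k),
    w = drop p.2 (levels (e p.1)),
    closure (res (t k) 0) `<=` ball (witness (e p.1)) k.+1%:R^-1%R &
    (forall i m, (i < size w)%N -> (m <= k)%N ->
      closure (res (t k) 0) `<=` res (nth (level0 T) w i) m) /\
    (forall m, (m <= k)%N -> closure (res (t k) 0) `<=` gen (top w) m)].
  move=> k0; have [_ /(_ k0)[p [vp dp [d [ed db dr dg]]]]] := eP k.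
  have td : t k = d by rewrite /t ed.
  by exists p, (drop p.2 (levels (e p.1))); rewrite td.
split.
- by move=> k m; have [] := opens k m.
- by move=> k m; have [] := opens k m.
- move=> k1 k2 k3 [k12 [l1 l10 e1]] [k23 [l2 l20 e2]]; split.
    exact: ltn_trans k23.
  exists (l2 ++ l1); last by rewrite e2 e1 catA.
  by rewrite size_cat addn_gt0 l20.
- by move=> k k' [].
- move=> k k' m [kk' [[//|d l] _ e1]] mk'.
  have [p [w [ew _ _ _ [wr _]]]] := childP k' (leq_ltn_trans (leq0n _) kk').
  move: e1; rewrite ew => -[_ wl].
  have := wr (size l) m; rewrite wl nth_cat ltnn subnn; apply=> //.
  by rewrite size_cat -ltn_subLR // subnn nonempty.
- by move=> k; have [[]] := eP k.
- by move=> k /childP[p [w [_ _ _ kb _]]]; exists (witness (e p.1)).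
- by move=> k; have [[_ _ _ _ []]] := eP k.
- move=> k k' kk'; have [[_ _ _ _ [_ kh _ _]] _] := eP k'.
  rewrite -subset0 -kh => x [kx Vx]; split=> //.
  by exists k => //; exact: subset_closure.
- move=> s u N su.
  have [l el] : exists l, levels (e u) = l ++ levels (e s).
    by case: su => [->|[_ [l _ el]]]; [exists [::]|exists l].
  have [k Nk dk] := decP (u, size l) (maxn N u.+1).
  move: Nk; rewrite geq_max => /andP[Nk uk]; exists k.
  have k0 : (0 < k)%N by exact: leq_ltn_trans uk.
  have [p [w [ew [vp dp] wp kb [_ wg]]]] := childP k k0.
  have pE : p = (u, size l).
    rewrite -dk; apply: dp; rewrite dk /valid /= uk /= el size_cat.
    by rewrite -ltn_subLR // subnn nonempty.
  have wE : w = levels (e s) by rewrite wp pE /= el drop_size_cat.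
  split=> //.
  - split; last by exists [:: t k] => //; rewrite ew wE.
    by case: su => [->//|[su _]]; exact: ltn_trans uk.
  - move=> x /kb; rewrite pE /=; apply: le_ball.
    by rewrite lef_pV2 ?posrE ?ltr0n // ler_nat.
  - by move=> m mN; have := wg m (leq_trans mN Nk); rewrite wE.
Qed.

End scheme_existence.

Lemma nested_closed_nonempty (R : realType) (T : pseudoMetricType R)
    (C : nat -> set T) : complete_space T ->
  (forall n, closed (C n)) -> (forall n, C n.+1 `<=` C n) ->
  (forall n, C n !=set0) ->
  (forall e : R, (0 < e)%R -> exists n z, C n `<=` ball z e) ->
  exists x, forall n, C n x.
Proof.
move=> cT cC CS C0 Ce.
have Cle n m : (n <= m)%N -> C m `<=` C n.
  elim: m => [|m IH]; first by rewrite leqn0 => /eqP ->.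
  rewrite leq_eqVlt => /orP[/eqP -> //|]; rewrite ltnS => /IH.
  exact: subset_trans.
pose F : set_system T := [set A | exists n, C n `<=` A].
have FF : ProperFilter F.
  split; first by move=> [n nC]; have [x /nC] := C0 n.
  split; first by exists 0%N.
  - move=> A B [n nA] [m mB]; exists (maxn n m) => x Cx; split.
      by apply: nA; apply: Cle Cx; exact: leq_maxl.
    by apply: mB; apply: Cle Cx; exact: leq_maxr.
  - by move=> A B AB [n nA]; exists n; exact: subset_trans AB.
have [|x Fx] := cT F FF.
  by apply: cauchy_exP => e /Ce[n [z nz]]; exists z; exists n.
exists x => n; apply: cC => B /Fx[m mB].
have [z Cz] := C0 (maxn n m); exists z; split.
  by apply: Cle Cz; exact: leq_maxl.
by apply: mB; apply: Cle Cz; exact: leq_maxr.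
Qed.

Section small_balls.
Context {R : realType} {T : pseudoMetricType R}.

Lemma small_radius (e : R) : (0 < e)%R ->
  exists N, forall n, (N <= n)%N -> (n.+1%:R^-1 <= e)%R.
Proof.
move=> e0; exists (Num.truncn e^-1%R) => n Nn.
rewrite -[leRHS]invrK lef_pV2 ?posrE ?ltr0n ?invr_gt0 //.
apply/ltW; apply: lt_le_trans (truncnS_gt _) _.
by rewrite ler_nat.
Qed.

Lemma open_ball_sub (x : T) (U : set T) : open U -> U x ->
  exists2 e : R, (0 < e)%R & ball x e `<=` U.
Proof.
move=> oU Ux; have /nbhs_ballP[e e0 eU] := open_nbhs_nbhs (conj oU Ux).
by exists e.
Qed.

End small_balls.

Section scheme_theory.
Context {R : realType} {T : pseudoMetricType R} {Y : topologicalType} {f : T -> Y}.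
Variables (b : nat -> set T) (V : nat -> set Y) (H O : nat -> nat -> set T).
Variables (y : nat -> T) (ext : nat -> nat -> Prop).
Hypotheses (cT : complete_space T) (bP : regular_base b).
Hypothesis (sch : scheme f H O V y ext).

Definition branch (be : nat -> nat) (x : T) : Prop :=
  (forall n, ext (be n) (be n.+1)) /\ forall n, closure (H (be n) 0%N) x.

Lemma branch_ext be n m : (forall n, ext (be n) (be n.+1)) -> (n < m)%N ->
  ext (be n) (be m).
Proof.
move=> bS; elim: m => // m IH; rewrite ltnS leq_eqVlt => /orP[/eqP ->//|/IH nm].
exact: (scheme_trans sch nm (bS m)).
Qed.

Lemma branch_ge be n : (forall n, ext (be n) (be n.+1)) -> (n <= be n)%N.
Proof.
move=> bS; elim: n => // n IH.
exact: leq_ltn_trans IH (scheme_lt sch (bS n)).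
Qed.

Lemma branch_small be x U : branch be x -> open U -> U x ->
  exists N, forall n, (N <= n)%N -> closure (H (be n) 0%N) `<=` U.
Proof.
move=> [bS bx] oU Ux; have [e e0 eU] := open_ball_sub oU Ux.
have e20 : (0 < e / 2)%R by rewrite divr_gt0.
have [N NP] := small_radius e20; exists N.+1 => n Nn.
have nb := branch_ge n bS.
have [|z zH] := scheme_radius sch (k := be n).
  exact: leq_trans (leq_trans (ltn0Sn _) Nn) nb.
move=> x' /zH zx'; apply: eU; have zx := zH _ (bx n).
have le : ((be n).+1%:R^-1 <= e / 2)%R.
  by apply: NP; exact: leq_trans (leq_trans (leqnSn _) Nn) nb.
apply: (@ball_splitr _ _ z); first exact: le_ball zx.
exact: le_ball zx'.
Qed.

Lemma branch_avoid be x : branch be x -> (~` \bigcup_k V k) (f x).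
Proof.
move=> [bS bx] [k _ Vx].
have kb : (k < be k.+1)%N by exact: branch_ge.
have : set0 x; last by [].
rewrite -(scheme_avoid sch kb); split=> // m _.
pose m' := maxn m k.+2.
apply: (scheme_nested sch (branch_ext bS (_ : k.+1 < m')%N)) (bx _).
  exact: leq_maxr.
by apply: leq_trans (branch_ge _ bS); exact: leq_maxl.
Qed.

Lemma branch_exists be : (forall n, ext (be n) (be n.+1)) ->
  exists x, branch be x.
Proof.
move=> bS.
have [||||x xC] := @nested_closed_nonempty R T
  (fun n => closure (H (be n) 0%N)) cT.
- by move=> n; exact: closed_closure.
- move=> n; apply: subset_trans (@subset_closure _ _).
  exact: (scheme_nested sch (bS n) _).
- by move=> n; exists (y (be n)); exact: (scheme_point sch).
- move=> e e0; have [N NP] := small_radius e0; exists N.+1.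
  have Nb := branch_ge N.+1 bS.
  have [|z zH] := scheme_radius sch (k := be N.+1).
    exact: leq_trans Nb.
  exists z => x /zH; apply: le_ball; apply: NP.
  by exact: ltnW.
by exists x.
Qed.

Lemma scheme_not_Sigma03 : ~ Sigma03 (f @^-1` (~` \bigcup_k V k)).
Proof.
move=> [Q GQ defZ].
have QZ n x : Q n x -> ~ (exists k, V k (f x)).
  move=> Qx [k Vx]; have : (f @^-1` (~` \bigcup_k V k)) x by rewrite defZ; exists n.
  by apply; exists k.
(* Baire category: otherwise a branch avoiding every [Q n] could be built. *)
have [s [n sn]] : exists s n, forall u, s = u \/ ext s u ->
    exists be x, [/\ be 0%N = u, branch be x & Q n x].
  apply: contrapT => nsn.
  have ns s n : exists u, (s = u \/ ext s u) /\
      forall be x, be 0%N = u -> branch be x -> ~ Q n x.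
    apply: contrapT => nu; apply: nsn; exists s, n => u su.
    apply: contrapT => nb; apply: nu; exists u; split=> // be x b0 bx Qx.
    by apply: nb; exists be, x.
  have [||be [_ _ bR]] := @indexed_dependent_choice nat (fun _ _ => True)
    (fun n s s' => exists u, [/\ s = u \/ ext s u,
      (forall be x, be 0%N = u -> branch be x -> ~ Q n x) & ext u s']) 0%N => //.
    move=> n s _; have [u [su un]] := ns s n.
    have [s' [_ us' _ _]] := scheme_dense sch 0%N (or_introl (erefl u)).
    by exists s'; split=> //; exists u.
  have bS n : ext (be n) (be n.+1).
    by have [u [[->//|bu] _ ub]] := bR n; exact: (scheme_trans sch bu ub).
  have [x [_ bx]] := branch_exists bS.
  have : (f @^-1` (~` \bigcup_k V k)) x by exact: branch_avoid (conj bS bx).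
  rewrite defZ => -[n _ Qx]; have [u [_ un ub]] := bR n.
  pose al m := if m is m'.+1 then be (n.+1 + m')%N else u.
  apply: (un al x _ _ Qx) => //; split=> -[|m] /=.
  - by rewrite addn0.
  - by rewrite addnS; exact: bS.
  - by apply/subset_closure/(scheme_nested sch ub (leq0n _))/(bx n.+1).
  - exact: bx.
have [F oF QF] := GQ n.
(* Alternate between branches meeting [Q n] and children of [s], so that the nested
   open sets [p.2] enter every [F j] and every [O s j]. *)
pose Inv (_ : nat) (p : nat * set T) :=
  [/\ s = p.1 \/ ext s p.1, open p.2 & closure (H p.1 0%N) `<=` p.2].
pose Rl j (p q : nat * set T) := [/\ closure q.2 `<=` p.2 `&` F j, q.2 `<=` O s j,
  q.2 !=set0 & exists z, closure q.2 `<=` ball z (j.+1%:R^-1 : R)%R].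
have [||E [_ _ ER]] := @indexed_dependent_choice _ Inv Rl (s, setT).
- by split=> //; [left|exact: openT].
- move=> j [u N] [/= su oN uN].
  have [be [p [b0 bp Qp]]] := sn u su.
  have Np : N p by apply: uN; rewrite -b0; case: bp => _; exact.
  have Fp : F j p by move: Qp; rewrite QF; exact.
  pose rad : R := (j.+1%:R^-1)%R.
  have rad0 : (0 < rad)%R by rewrite invr_gt0 ltr0n.
  pose B := (ball p rad)°.
  have Bp : B p by exact: (nbhsx_ballx _ _ rad0).
  have [|//|i [bp_i iN]] := bP.2 p (N `&` F j `&` B).
    by apply: openI; [exact: openI|exact: open_interior].
  have [m mP] := branch_small bp (bP.1 i) bp_i.
  have /mP wb := leqnSn m.
  set w := be m.+1 in wb.
  have sw : ext s w.
    have uw : ext u w by rewrite -b0; exact: branch_ext bp.1 _.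
    by case: su => [->//|su]; exact: (scheme_trans sch su uw).
  have [e e0 eb] := open_ball_sub (bP.1 i) (wb _ (scheme_point sch (k := w))).
  have [M MP] := small_radius e0.
  have [k [_ sk kw kO]] := scheme_dense sch (maxn M j) (or_intror sw).
  have kb : closure (H k 0%N) `<=` b i.
    apply: subset_trans kw _; apply: subset_trans eb; apply: le_ball.
    by apply: MP; exact: leq_maxl.
  have kOj : closure (H k 0%N) `<=` O s j by apply: kO; exact: leq_maxr.
  exists (k, b i `&` O s j); split; split=> /=.
  + by apply: subset_trans (closureS (@subIsetl _ _ _)) _ => x /iN[].
  + exact: subIsetr.
  + by exists (y k); split; [apply: kb|apply: kOj]; exact: (scheme_point sch).
  + exists p; apply: subset_trans (closureS (@subIsetl _ _ _)) _ => x /iN[_].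
    exact: interior_subset.
  + by right.
  + by apply: openI; [exact: (bP.1 i)|exact: scheme_openO sch _ _].
  + by move=> x Hx; split; [exact: kb|exact: kOj].
have [||||x xE] := @nested_closed_nonempty R T (fun j => closure (E j.+1).2) cT.
- by move=> j; exact: closed_closure.
- move=> j; have [+ _ _ _] := ER j.+1 => cl x /cl[Ex _].
  exact: subset_closure.
- by move=> j; have [_ _ [z Ez] _] := ER j; exists z; exact: subset_closure.
- move=> e e0; have [N NP] := small_radius e0; exists N.
  have [_ _ _ [z zE]] := ER N; exists z => x /zE; apply: le_ball; exact: NP.
apply: (QZ n x).
  by rewrite QF => j _; have [cl _ _ _] := ER j; have [] := cl _ (xE j).
exists s; apply: (scheme_generic sch) => j _.
have [_ EO _ _] := ER j; apply: EO.
by have [cl _ _ _] := ER j.+1; have [] := cl _ (xE j.+1).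
Qed.

End scheme_theory.

Section preimages.
Context {S T : topologicalType} {h : S -> T} (ch : continuous h).

Lemma Fsigma_preimage A : Fsigma A -> Fsigma (h @^-1` A).
Proof.
move=> [F cF ->]; rewrite preimage_bigcup; apply: Fsigma_bigcup => i _.
by apply: closed_Fsigma; move/continuous_closedP : ch; exact.
Qed.

Lemma Gdelta_preimage A : Gdelta A -> Gdelta (h @^-1` A).
Proof. by rewrite !GdeltaC preimage_setC; exact: Fsigma_preimage. Qed.

Lemma Sigma03_preimage A : Sigma03 A -> Sigma03 (h @^-1` A).
Proof.
move=> [G GG ->]; rewrite preimage_bigcup; apply: Sigma03_bigcup => i _.
exact/Gdelta_Sigma03/Gdelta_preimage.
Qed.

Lemma small_preimage (Y : topologicalType) (f : T -> Y) (A : set T) :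
  small f A -> small (f \o h) (h @^-1` A).
Proof.
move=> [P [GP AP fP]]; exists (fun k => h @^-1` P k); split.
- by move=> k; exact: Gdelta_preimage.
- by rewrite -preimage_bigcup; exact: preimage_subset.
- move=> k U /(fP k)[B FB PB]; exists (h @^-1` B); first exact: Fsigma_preimage.
  exact: (congr1 (fun C => h @^-1` C) PB).
Qed.

Lemma separable_image (g : T -> S) : cancel g h -> separable S -> separable T.
Proof.
move=> gK [D cD dD]; exists (h @` D).
  by apply: card_le_trans cD; exact: card_image_le.
move=> U [y Uy] oU; have [||x [Ux Dx]] := dD (h @^-1` U).
- by exists (g y); rewrite /preimage /= gK.
- by move/continuousP : ch; exact.
- by exists (h x); split=> //; exists x.
Qed.

End preimages.

Lemma pseudometric_regular_base (R : realType) (T : pseudoMetricType R) :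
  separable T -> exists b : nat -> set T, regular_base b.
Proof.
move=> [D /countable_injP[code code_inj] dD].
exists (fun n => if unpickle n is Some (i, q)
  then \bigcup_(d in [set d | D d /\ code d = i])
         (ball d (q.+1%:R^-1 : R)%R)° else set0); split.
  move=> n; case: unpickle => [[i q]|]; last exact: open0.
  by apply: bigcup_open => d _; exact: open_interior.
move=> x U oU Ux; have [e e0 eU] := open_ball_sub oU Ux.
have e40 : (0 < e / 2 / 2)%R by rewrite !divr_gt0.
have [q qP] := small_radius e40; pose r : R := (q.+1%:R^-1)%R.
have r0 : (0 < r)%R by rewrite invr_gt0 ltr0n.
have re : (r <= e / 2 / 2)%R by exact: qP.
have [||d [/interior_subset xd Dd]] := dD (ball x (r / 2)%R)°.
- by exists x; apply: nbhsx_ballx; rewrite divr_gt0.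
- exact: open_interior.
exists (pickle (code d, q)); rewrite pickleK; split.
  exists d => //; rewrite /interior /=.
  apply: (@filterS _ (nbhs x) _ (ball x (r / 2)%R)).
    by move=> z xz; exact: ball_splitr xd xz.
  by apply: nbhsx_ballx; rewrite divr_gt0.
move=> z /(_ _ (nbhsx_ballx _ _ r0))[w [[d' [Dd' cd'] /interior_subset]]].
rewrite (code_inj d' d) ?inE // => dw zw; apply: eU.
apply: (@ball_split _ _ d).
  apply: le_ball xd; apply: le_trans (_ : r <= _)%R.
    by rewrite ler_pdivrMr // ler_peMr ?ler1n // ltW.
  by apply: le_trans re _; rewrite ler_pdivrMr // ler_peMr ?ler1n // ltW // divr_gt0.
apply: (@ball_split _ _ w); first exact: le_ball dw.
by apply: ball_sym; exact: le_ball zw.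
Qed.

Section homeomorphism.
Context {S T : topologicalType} {h : S -> T} {g : T -> S}.
Hypotheses (hK : cancel h g) (gK : cancel g h).
Hypotheses (ch : continuous h) (cg : continuous g).

Lemma regular_base_preimage (b : nat -> set T) :
  regular_base b -> regular_base (fun n => h @^-1` b n).
Proof.
move=> bP; split=> [n|x U oU Ux].
  by move/continuousP : ch; apply; exact: (bP.1 n).
have [||n [bx bU]] := bP.2 (h x) (g @^-1` U).
- by move/continuousP : cg; exact.
- by rewrite /preimage /= hK.
exists n; split=> // z zb; rewrite -(hK z); apply: bU => B /ch/zb[w [bw Bw]].
by exists (h w).
Qed.

End homeomorphism.

Section decomposition.
Context {T Y : topologicalType} {f : T -> Y} (b : nat -> set T).
Hypothesis bP : regular_base b.

Lemma Delta03C (A : set T) : Delta03 A -> Delta03 (~` A).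
Proof. by move=> [sA sCA]; split=> //; rewrite setCK. Qed.

Lemma Delta03I (A B : set T) : Delta03 A -> Delta03 B -> Delta03 (A `&` B).
Proof.
move=> [sA sCA] [sB sCB]; split; first exact: Sigma03I.
rewrite setCI -bigcup2E; apply: Sigma03_bigcup => -[|[|n]] _ //=.
exact/open_Sigma03/open0.
Qed.

Lemma Delta03U (A B : set T) : Delta03 A -> Delta03 B -> Delta03 (A `|` B).
Proof.
move=> dA dB; rewrite -[_ `|` _]setCK setCU.
by apply/Delta03C/Delta03I; exact: Delta03C.
Qed.

Lemma Gdelta_Delta03 (A : set T) : Gdelta A -> Delta03 A.
Proof.
move=> GA; split; first exact: Gdelta_Sigma03.
by apply: (Fsigma_Sigma03 bP); exact/GdeltaC.
Qed.

Lemma Sigma02_on_sigL (A : set T) :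
  Sigma02_on f A -> Sigma02_measurable (sigL A f).
Proof.
move=> fA U /fA[B FB AB].
rewrite (_ : _ @^-1` _ = set_val @^-1` B).
  by apply: Fsigma_preimage FB; exact: initial_continuous.
apply/seteqP; split=> -[x xA] /= Hx.
- have : (A `&` f @^-1` U) x by split=> //; exact: set_mem.
  by rewrite AB => -[].
- have : (A `&` B) x by split=> //; exact: set_mem.
  by rewrite -AB => -[].
Qed.

Lemma small_dec : small f setT -> dec_Sigma02_Delta03 f.
Proof.
move=> [P [GP TP fP]]; exists (seqDU P); split.
- by rewrite -seqDU_bigcup_eq -subTset.
- exact: trivIset_seqDU.
- move=> k; rewrite /seqDU setDE; apply: Delta03I; first exact: Gdelta_Delta03.
  apply: Delta03C; elim/big_ind : _ => [|A B|i _]; last exact: Gdelta_Delta03.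
    exact/Gdelta_Delta03/open_Gdelta/open0.
  exact: Delta03U.
- move=> k; apply: Sigma02_on_sigL; apply: Sigma02_onS (fP k).
  exact: subset_seqDU.
Qed.

Lemma dec_Sigma03_preimage : dec_Sigma02_Delta03 f ->
  forall A, Fsigma A -> Sigma03 (f @^-1` A).
Proof.
move=> [P [TP _ dP fP]] A [F cF ->]; rewrite preimage_bigcup.
apply: Sigma03_bigcup => i _.
rewrite -[X in Sigma03 X]setTI -TP setI_bigcupl; apply: Sigma03_bigcup => k _.
have := fP k _ (closed_openC (cF i)); rewrite -preimage_setC => /GdeltaC[O oO FO].
have /choice[U UP] m : exists U : set T, open U /\ set_val @^-1` U = O m.
  by have [U oU UO] := oO m; exists U.
suff -> : P k `&` f @^-1` F i = P k `&` \bigcap_m U m.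
  apply: Sigma03I; first by case: (dP k).
  by apply: Gdelta_Sigma03; exists U => // m; case: (UP m).
have FU (x : P k) : F i (f (set_val x)) <-> (\bigcap_m U m) (set_val x).
  rewrite -[F i _]/((sigL (P k) f @^-1` F i) x) FO.
  split=> Ox m _; have := Ox m I; rewrite -(UP m).2; exact.
apply/seteqP; split=> x [Px] Hx; split=> //.
- by apply/(FU (SigSub (mem_set Px))).
- by apply/(FU (SigSub (mem_set Px))).
Qed.

End decomposition.

Lemma metrizable_regular_base (R : realType) (T : topologicalType) :
  separable T -> metrizable R T -> exists b : nat -> set T, regular_base b.
Proof.
move=> sT [M [h [g [hK gK ch cg]]]].
have [b bP] := pseudometric_regular_base (separable_image ch gK sT).
by exists (fun n => h @^-1` b n); exact: (regular_base_preimage hK ch cg bP).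
Qed.

Theorem theorem3p6 (R : realType) (X Y : topologicalType) (f : X -> Y)
    (polishX : polish R X) (separableY : separable Y)
    (metrizableY : metrizable R Y) :
  (forall A : set Y, Fsigma A -> Sigma03 (f @^-1` A)) <->
  dec_Sigma02_Delta03 f.
Proof.
split; last exact: dec_Sigma03_preimage.
move=> fS; have [sX [M cM [h [g [hK gK ch cg]]]]] := polishX.
have [c cP] := metrizable_regular_base separableY metrizableY.
have [b bP] := pseudometric_regular_base (separable_image ch gK sX).
have fgS A : Fsigma A -> Sigma03 ((f \o g) @^-1` A).
  by move=> /fS; rewrite comp_preimage; exact: Sigma03_preimage.
apply: (small_dec (regular_base_preimage hK ch cg bP)).
suff fgT : small (f \o g) [set: M].
  have := small_preimage ch fgT; rewrite preimage_setT.
  by rewrite (_ : _ \o h = f) //; apply/funext => x /=; rewrite hK.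
apply: contrapT => /(scheme_exists bP cP)[U /(open_Fsigma cP)/fgS //|].
move=> H [O [v [y [ext sch]]]]; apply: (scheme_not_Sigma03 cM bP sch).
apply/fgS/closed_Fsigma/open_closedC/bigcup_open => k _; exact: (cP.1 (v k)).
Qed.
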